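(* Let $F(x,y)=(x-P(x,y)+X(x,y),\; y+Q(x,y)+Y(x,y))$ be a map of the plane of the form described in the context. Suppose that the symmetric coefficient tensors $\mathscr A,\mathscr B,\mathscr C,\mathscr D,\mathscr E,\mathscr H$ of $$\frac{\partial P}{\partial x},\quad \frac{\partial Q}{\partial y},\quad \frac{\partial P}{\partial x}+\frac{\partial P}{\partial y},\quad \frac{\partial P}{\partial x}-\frac{\partial P}{\partial y},\quad \frac{\partial Q}{\partial y}+\frac{\partial Q}{\partial x},\quad \frac{\partial Q}{\partial y}-\frac{\partial Q}{\partial x},$$ respectively, are all positive definite. Then there exist a neighborhood $N$ of $\mathbf 0=(0,0)$ and $\delta>0$ such that the stable and unstable sets $W^s(F,N)$ and $W^u(F,N)$ are the graphs of two Lipschitz functions $\varphi^s,\varphi^u:[-\delta,\delta]\to\mathbb R$, namely $W^s(F,N)=\{(x,\varphi^s(x)): x\in[-\delta,\delta]\}$ and $W^u(F,N)=\{(\varphi^u(y),y): y\in[-\delta,\delta]\}$.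
   Context: Setting: $F=(f,g):\mathbb R^2\to\mathbb R^2$, $F(x,y)=(x-P(x,y)+X(x,y),\,y+Q(x,y)+Y(x,y))$, where $P$ and $Q$ are real homogeneous polynomials in two variables of degrees $2k+1$ and $2k'+1$ respectively, with $k,k'\ge 1$ integers, and $X,Y$ are higher-order terms than $P,Q$ respectively: $X,Y$ are $C^1$ functions with $X(0,0)=Y(0,0)=0$ and, as $(x,y)\to(0,0)$, the first partial derivatives of $X$ are $o(\|(x,y)\|^{2k})$ and those of $Y$ are $o(\|(x,y)\|^{2k'})$ (hence $X=o(\|(x,y)\|^{2k+1})$, $Y=o(\|(x,y)\|^{2k'+1})$). Thus $\mathbf 0=(0,0)$ is a fixed point of $F$. Tensors: for a real homogeneous polynomial $R$ of degree $m$ in $\mathbf x=(x_1,\dots,x_n)$, its symmetric coefficient tensor is the unique symmetric array $\mathscr B=(b_{i_1\cdots i_m})$ with $R(\mathbf x)=\mathscr B\mathbf x^m:=\sum_{i_1,\dots,i_m=1}^n b_{i_1\cdots i_m}x_{i_1}\cdots x_{i_m}$. A tensor $\mathscr B$ is positive definite if $\mathscr B\mathbf x^m>0$ for all $\mathbf x\in\mathbb R^n\setminus\{0\}$. For a neighborhood $N$ of $\mathbf 0$: $$W^s(F,N)=\{(x,y)\in N:\ F^j(x,y)\in N\ \forall j\ge 0,\ \lim_{j\to+\infty}F^j(x,y)=(0,0)\},$$ $$W^u(F,N)=\{(x,y)\in N:\ F^{-j}(x,y)\in N\ \forall j\ge 0,\ \lim_{j\to+\infty}F^{-j}(x,y)=(0,0)\},$$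 where $F^{-1}$ denotes the local inverse of $F$ near $\mathbf 0$ (note $DF(\mathbf 0)$ is the identity). *)

(* Defs.v *)
(* MathComp, MathComp-Analysis and multinomials. The notations of mpoly are not
   imported, because they clash with those of MathComp-Analysis. *)
From HB Require Import structures.
From mathcomp Require Import all_boot all_order all_algebra.
From mathcomp Require Import all_classical all_reals all_analysis.
From mathcomp Require mpoly.
Import (canonicals, coercions) mpoly.
Set Implicit Arguments.
Unset Strict Implicit.
Unset Printing Implicit Defensive.
Import Order.TTheory GRing.Theory Num.Theory.
Import numFieldNormedType.Exports.
Local Open Scope classical_set_scope.
Local Open Scope ring_scope.

Notation mpolynomial n R := (mpoly.mpoly n R).
Notation mderiv := mpoly.mderiv.
Notation meval := mpoly.meval.

Definition homogeneous (R : realType) (n d : nat) (p : mpolynomial n R) : Prop :=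
  p \is mpoly.ishomog1 d (@mpoly.mdeg n).

Definition tensor (R : realType) (n m : nat) := m.-tuple 'I_n -> R.

Definition tensor_form (R : realType) (n m : nat) (B : tensor R n m)
    (x : 'rV[R]_n) : R :=
  \sum_(t : m.-tuple 'I_n) B t * \prod_(j < m) x 0 (tnth t j).

Definition symmetric_tensor (R : realType) (n m : nat) (B : tensor R n m) :=
  forall s t : m.-tuple 'I_n, perm_eq s t -> B s = B t.

(* B is the symmetric tensor of order m with p(x) = B x^m; a symmetric tensor is
   determined by the values of its form, so there is at most one such B. *)
Definition coef_tensor (R : realType) (n m : nat) (p : mpolynomial n R)
    (B : tensor R n m) :=
  symmetric_tensor B /\
  forall x : 'rV[R]_n, meval (x 0) p = tensor_form B x.

Definition positive_definite (R : realType) (n m : nat) (B : tensor R n m) :=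
  forall x : 'rV[R]_n, x != 0 -> 0 < tensor_form B x.

Definition eval2 (R : realType) (p : mpolynomial 2 R) (z : R * R) : R :=
  meval (tnth [tuple z.1; z.2]) p.

Definition pderiv_x (R : realType) (p : mpolynomial 2 R) := mderiv ord0 p.
Definition pderiv_y (R : realType) (p : mpolynomial 2 R) := mderiv ord_max p.

Definition partial_x (R : realType) (f : R * R -> R) (z : R * R) : R :=
  'D_((1, 0) : R * R) f z.
Definition partial_y (R : realType) (f : R * R -> R) (z : R * R) : R :=
  'D_((0, 1) : R * R) f z.

Definition C1 (R : realType) (f : R * R -> R) :=
  [/\ forall z, differentiable f z,
      continuous (partial_x f) & continuous (partial_y f)].

(* The norm on R * R is the maximum norm; the choice of norm does not affect
   the meaning of the little-o. *)
Definition higher_order (R : realType) (m : nat) (f : R * R -> R) :=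
  [/\ C1 f, f (0, 0) = 0,
      partial_x f =o_ ((0, 0) : R * R) (fun z : R * R => `|z| ^+ m) &
      partial_y f =o_ ((0, 0) : R * R) (fun z : R * R => `|z| ^+ m)].

Definition planar_map (R : realType) (P Q : mpolynomial 2 R)
    (X Y : R * R -> R) (z : R * R) : R * R :=
  (z.1 - eval2 P z + X z, z.2 + eval2 Q z + Y z).

(* Finv is the inverse of the bijection from U onto V induced by F; its values
   outside V are irrelevant. *)
Definition local_inverse (R : realType) (F : R * R -> R * R)
    (U V : set (R * R)) (Finv : R * R -> R * R) :=
  [/\ open_nbhs ((0, 0) : R * R) U, open_nbhs ((0, 0) : R * R) V,
      forall z, U z -> V (F z) /\ Finv (F z) = z &
      forall w, V w -> U (Finv w) /\ F (Finv w) = w].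

Definition stable_set (R : realType) (F : R * R -> R * R) (N : set (R * R)) :
    set (R * R) :=
  [set z | [/\ N z, forall j : nat, N (iter j F z) &
    (fun j : nat => iter j F z) @ \oo --> ((0, 0) : R * R)]].

(* Finv is a local inverse of the map, and N is contained in the set where Finv
   inverts it. *)
Definition unstable_set (R : realType) (Finv : R * R -> R * R)
    (N : set (R * R)) : set (R * R) :=
  [set z | [/\ N z, forall j : nat, N (iter j Finv z) &
    (fun j : nat => iter j Finv z) @ \oo --> ((0, 0) : R * R)]].

(* Main.v *)
(* For two points near 0, the mean value theorem writes the differences of the
   coordinates of their images as
     Df = (1 - p11) Dx - p12 Dy,   Dg = (1 + q22) Dy + q21 Dx,
   where, by homogeneity and positive definiteness, p11 - |p12| and q22 - |q21|
   are at least c |z|^m at the intermediate point z.  Hence the cone |Dx| <= |Dy|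
   is invariant, with |Dy| nondecreasing along orbits: two points of the stable
   set with |Dx| <= |Dy| coincide, as their distance tends to 0, and the stable
   set is the graph of a 1-Lipschitz function over its projection.  On a small
   square the orbits leave only through the top and the bottom, so that by
   connectedness every vertical segment contains a point whose orbit stays in the
   square; such an orbit never enters the cone |x| < |y|, where |y| would grow
   without bound, and then |x| decreases to 0.  The local inverse, with the two
   coordinates exchanged, satisfies the same hypotheses, which gives the unstable
   set. *)
Require Import Defs.
From HB Require Import structures.
From mathcomp Require Import all_boot all_order all_algebra.
From mathcomp Require Import all_classical all_reals all_analysis.
From mathcomp Require mpoly.
From mathcomp Require Import ring lra.
Import (canonicals, coercions) mpoly.
Import Order.TTheory GRing.Theory Num.Theory.
Import numFieldNormedType.Exports.
Local Open Scope classical_set_scope.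
Local Open Scope ring_scope.
Set Implicit Arguments.
Unset Strict Implicit.
Unset Printing Implicit Defensive.

(** * Stable sets of planar saddles *)

Lemma norm_pair_le (R : realType) (z : R * R) (d : R) :
  (`|z| <= d) = (`|z.1| <= d) && (`|z.2| <= d).
Proof. by rewrite prod_normE ge_max. Qed.

Lemma norm_pair_lt (R : realType) (z : R * R) (d : R) :
  (`|z| < d) = (`|z.1| < d) && (`|z.2| < d).
Proof. by rewrite prod_normE gt_max. Qed.

Lemma norm_fst_le (R : realType) (z : R * R) : `|z.1| <= `|z|.
Proof. by rewrite prod_normE le_max lexx. Qed.

Lemma norm_snd_le (R : realType) (z : R * R) : `|z.2| <= `|z|.
Proof. by rewrite prod_normE le_max lexx orbT. Qed.

(** The 1-Lipschitz retraction onto [[- d, d]]. A map controlled only on a square obeys global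
    estimates once [clamp2] is applied first. *)
Definition clamp (R : realType) (d x : R) : R := Num.max (- d) (Num.min d x).

Definition clamp2 (R : realType) (d : R) (z : R * R) : R * R :=
  (clamp d z.1, clamp d z.2).

Lemma clamp_lip (R : realType) (d x y : R) : `|clamp d x - clamp d y| <= `|x - y|.
Proof.
have H1 := ler_norm (x - y); have := ler_norm (y - x); rewrite distrC => H2.
rewrite /clamp /Num.max /Num.min ler_norml; apply/andP; split;
  by do !case: ifPn; rewrite -?leNgt => *; lra.
Qed.

Lemma clamp_norm (R : realType) (d x : R) : 0 <= d -> `|clamp d x| <= d.
Proof.
by move=> d0; rewrite /clamp ler_norml le_max lexx /= ge_max ge_min lexx /= andbT; lra.
Qed.

Lemma clamp_id (R : realType) (d x : R) : `|x| <= d -> clamp d x = x.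
Proof. by rewrite ler_norml => /andP[dx xd]; rewrite /clamp min_r// max_r. Qed.

Lemma clamp_ge (R : realType) (d x : R) : 0 <= d -> d <= x -> clamp d x = d.
Proof. by move=> d0 dx; rewrite /clamp min_l// max_r//; lra. Qed.

Lemma clamp_le (R : realType) (d x : R) : 0 <= d -> x <= - d -> clamp d x = - d.
Proof. by move=> d0 dx; rewrite /clamp min_r ?max_l//; lra. Qed.

Lemma clamp2_lip (R : realType) (d : R) (z w : R * R) :
  `|clamp2 d z - clamp2 d w| <= `|z - w|.
Proof.
rewrite norm_pair_le; apply/andP; split.
  exact: le_trans (clamp_lip _ _ _) (norm_fst_le (z - w)).
exact: le_trans (clamp_lip _ _ _) (norm_snd_le (z - w)).
Qed.

Lemma clamp2_norm (R : realType) (d : R) (z : R * R) :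
  0 <= d -> `|clamp2 d z| <= d.
Proof. by move=> d0; rewrite norm_pair_le !clamp_norm. Qed.

Lemma clamp2_id (R : realType) (d : R) (z : R * R) :
  `|z| <= d -> clamp2 d z = z.
Proof. by case: z => x y; rewrite norm_pair_le /clamp2 => /andP[/= xd yd]; rewrite !clamp_id. Qed.

(** The Archimedean property. It excludes both an orbit growing forever in the vertical cone and a
    first coordinate that decreases without tending to 0. *)
Lemma unbounded_of_increments (R : realType) (a : nat -> R) (M e : R) :
  0 < e -> (forall n, a n <= M) -> ~ (forall n, a n + e <= a n.+1).
Proof.
move=> e0 aM ae.
have ane n : a 0 + e * n%:R <= a n.
  elim: n => [|n IH]; first by rewrite mulr0 addr0.
  by have := ae n; rewrite -natr1; lra.
have /= := archi_boundP (_ : 0 <= `|(M - a 0) / e|).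
move=> /(_ (normr_ge0 _)); set n := Num.bound _ => H.
have : M - a 0 < e * n%:R.
  by rewrite -ltr_pdivrMl// mulrC (le_lt_trans (ler_norm _)).
by have := ane n; have := aM n; lra.
Qed.

(* [saddle_contract] assumes that the image also lies in the horizontal cone, and
   [saddle_block] only controls the first coordinate of the points that do not
   leave through the top or the bottom: in this weak form both conditions also
   hold for the inverse map with the coordinates exchanged. *)
Record saddle (R : realType) (d c : R) (m : nat) (T : R * R -> R * R) : Prop :=
  Saddle {
  saddle_d_gt0 : 0 < d;
  saddle_c_gt0 : 0 < c;
  saddle_lip : forall a b, `|a| <= d -> `|b| <= d -> `|T a - T b| <= 2 * `|a - b|;
  saddle_near_id : forall a, `|a| <= d -> `|T a - a| <= `|a| / 2;
  saddle_cone : forall a b, `|a| <= d -> `|b| <= d ->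
    `|a.1 - b.1| <= `|a.2 - b.2| ->
    `|(T a).1 - (T b).1| <= `|(T a).2 - (T b).2| /\
    `|a.2 - b.2| <= `|(T a).2 - (T b).2|;
  saddle_expand : forall a, `|a| <= d -> `|a.1| <= `|a.2| ->
    `|a.2| + c * `|a.2| ^+ m <= `|(T a).2|;
  saddle_contract : forall a, `|a| <= d -> `|a.2| <= `|a.1| ->
    `|(T a).2| <= `|(T a).1| -> `|(T a).1| <= `|a.1| - c * `|a.1| ^+ m;
  saddle_block : forall a, `|a| <= d -> `|(T a).2| <= d -> `|(T a).1| <= d }.

Lemma saddle0 (R : realType) (d c : R) m (T : R * R -> R * R) :
  saddle d c m T -> T 0 = 0.
Proof.
move=> sT; have := @saddle_near_id _ _ _ _ _ sT 0.
rewrite normr0 subr0 mul0r => /(_ (ltW (saddle_d_gt0 sT))).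
by rewrite normr_le0 => /eqP.
Qed.

Lemma saddle_cone_iter (R : realType) (d c : R) m (T : R * R -> R * R) a b :
  saddle d c m T ->
  (forall j, `|iter j T a| <= d) -> (forall j, `|iter j T b| <= d) ->
  `|a.1 - b.1| <= `|a.2 - b.2| -> forall j,
  `|(iter j T a).1 - (iter j T b).1| <= `|(iter j T a).2 - (iter j T b).2| /\
  `|a.2 - b.2| <= `|(iter j T a).2 - (iter j T b).2|.
Proof.
move=> sT Na Nb ab; elim=> [//|j [IH1 IH2]].
by have [H1 H2] := saddle_cone sT (Na j) (Nb j) IH1; split=> //=; exact: le_trans H2.
Qed.

Lemma saddle_confined_cvg (R : realType) (d c : R) m (T : R * R -> R * R) z :
  saddle d c m T -> (forall j, `|iter j T z| <= d) ->
  (fun j => iter j T z) @ \oo --> ((0, 0) : R * R).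
Proof.
move=> sT Nz; have c0 := saddle_c_gt0 sT; have T0 := saddle0 sT.
have iter0 j : iter j T 0 = 0 by elim: j => //= j ->.
have d0 := saddle_d_gt0 sT.
have cone n : `|(iter n T z).2| <= `|(iter n T z).1|.
  rewrite leNgt; apply/negP => xy.
  have Nw j : `|iter j T (iter n T z)| <= d by rewrite -iterD.
  have N0 j : `|iter j T (0 : R * R)| <= d by rewrite iter0 normr0 ltW.
  (* Comparison with the constant orbit of 0 keeps the orbit of [w] in the vertical cone with second
     coordinate at least [|w.2|], so each step gains at least [c * |w.2| ^+ m]. *)
  have /= := saddle_cone_iter sT Nw N0; rewrite !subr0 => /(_ (ltW xy)).
  set w := iter n T z in xy Nw * => coneW.
  have w0 : 0 < `|w.2| by apply: le_lt_trans xy.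
  apply: (@unbounded_of_increments _ (fun j => `|(iter j T w).2|) d (c * `|w.2| ^+ m)).
  - by rewrite mulr_gt0// exprn_gt0.
  - by move=> j; apply: le_trans (norm_snd_le _) (Nw j).
  move=> j; have := coneW j; rewrite iter0 /= !subr0 => -[H1 H2].
  apply: le_trans (saddle_expand sT (Nw j) H1).
  by rewrite lerD// ler_pM2l// lerXn2r// nnegrE.
have step n := saddle_contract sT (Nz n) (cone n) (cone n.+1).
have mono : nonincreasing_seq (fun n => `|(iter n T z).1|).
  apply/nonincreasing_seqP => n; apply: le_trans (step n) _.
  by rewrite gerBl mulr_ge0 ?exprn_ge0// ltW.
apply/cvgrPdist_lt => e e0.
(* Otherwise each step would decrease the first coordinate by at least [c * e ^+ m]. *)
have [n ne] : exists n, `|(iter n T z).1| < e.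
  apply: contrapT => /forallNP H.
  apply: (@unbounded_of_increments _ (fun j => - `|(iter j T z).1|) 0 (c * e ^+ m)).
  - by rewrite mulr_gt0// exprn_gt0.
  - by move=> j; rewrite oppr_le0.
  move=> j; have := step j => /=.
  suff : c * e ^+ m <= c * `|(iter j T z).1| ^+ m by lra.
  rewrite ler_pM2l// lerXn2r// ?nnegrE// ?(ltW e0)// leNgt; exact/negP/H.
exists n => // p /= np; rewrite sub0r normrN norm_pair_lt.
have H := mono _ _ np.
by rewrite (le_lt_trans H)//= (le_lt_trans (cone p))// (le_lt_trans H).
Qed.

(* Outside the square the truncated map keeps pushing the points above it up
   and those below it down; the points of a vertical segment escaping upwards
   and those escaping downwards form disjoint open sets, which by connectedness
   do not cover the segment. *)
Lemma saddle_confined_exists (R : realType) (d c : R) m (T : R * R -> R * R) x :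
  saddle d c m T -> `|x| <= d -> exists y, forall j, `|iter j T (x, y)| <= d.
Proof.
move=> sT xd; have d0 := saddle_d_gt0 sT; have c0 := saddle_c_gt0 sT.
pose S := T \o clamp2 d.
have cN z : `|clamp2 d z| <= d by apply: clamp2_norm; exact: ltW.
(* Expansion pushes the image beyond height [d] in absolute value; the displacement bound [d / 2]
   prevents it from jumping to the opposite side. *)
have out w : `|(clamp2 d w).2| = d ->
    d < `|(S w).2| /\ `|(S w).2 - (clamp2 d w).2| <= d / 2.
  move=> n2; split; last first.
    apply: le_trans (norm_snd_le (S w - clamp2 d w)) _.
    by apply: le_trans (saddle_near_id sT (cN w)) _; rewrite ler_pM2r.
  have := saddle_expand sT (cN w); rewrite n2 => /(_ (clamp_norm _ (ltW d0))).
  by apply: lt_le_trans; rewrite ltrDl mulr_gt0// exprn_gt0.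
have up w : d <= w.2 -> d < (S w).2.
  move=> wd; have e2 : (clamp2 d w).2 = d by rewrite /= clamp_ge// ltW.
  have /out [] : `|(clamp2 d w).2| = d by rewrite e2 gtr0_norm.
  by rewrite e2 ltr_normr ler_norml => /orP[//|] ? /andP[] *; lra.
have dn w : w.2 <= - d -> (S w).2 < - d.
  move=> wd; have e2 : (clamp2 d w).2 = - d by rewrite /= clamp_le// ltW.
  have /out [] : `|(clamp2 d w).2| = d by rewrite e2 normrN gtr0_norm.
  by rewrite e2 ltr_normr ler_norml => /orP[|] ? /andP[] *; lra.
pose h n y := (iter n S (x, y)).2.
have upS n p y : (n <= p)%N -> d < h n y -> d < h p y.
  move=> /subnK <-; elim: (p - n)%N => // j IH /IH H.
  by rewrite /h addSn /=; exact/up/ltW.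
have dnS n p y : (n <= p)%N -> h n y < - d -> h p y < - d.
  move=> /subnK <-; elim: (p - n)%N => // j IH /IH H.
  by rewrite /h addSn /=; exact/dn/ltW.
have Slip a b : `|S a - S b| <= 2 * `|a - b|.
  apply: le_trans (saddle_lip sT (cN a) (cN b)) _.
  by rewrite ler_pM2l//; exact: clamp2_lip.
(* Truncation makes [S] 2-Lipschitz on the whole plane, so its iterates depend continuously on [y]
   even after leaving the square. *)
have hlip n y y' : `|h n y - h n y'| <= 2 ^+ n * `|y - y'|.
  apply: (le_trans (norm_snd_le (iter n S (x, y) - iter n S (x, y')))).
  elim: n => [|n IH] /=.
    by rewrite mul1r norm_pair_le /= subrr normr0 normr_ge0 lexx.
  by apply: le_trans (Slip _ _) _; rewrite exprS -mulrA ler_pM2l.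
have hcont n : continuous (h n).
  move=> y; apply/cvgrPdist_le => e e0; near=> y'.
  apply: le_trans (hlip _ _ _) _; rewrite -ler_pdivlMl ?exprn_gt0//.
  near: y'; apply: cvgr_dist_le; first exact: cvg_id.
  by rewrite mulr_gt0// invr_gt0 exprn_gt0.
pose up_set := [set y | exists n, d < h n y].
pose dn_set := [set y | exists n, h n y < - d].
have up_open : open up_set.
  have -> : up_set = \bigcup_n (h n @^-1` [set t | d < t]).
    by apply/seteqP; split=> y [n]; [exists n|exists n].
  apply: bigcup_open => n _; apply: open_comp => // y _; exact: hcont.
have dn_open : open dn_set.
  have -> : dn_set = \bigcup_n (h n @^-1` [set t | t < - d]).
    by apply/seteqP; split=> y [n]; [exists n|exists n].
  apply: bigcup_open => n _; apply: open_comp => // y _; exact: hcont.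
have disj y : up_set y -> dn_set y -> False.
  move=> [n /(upS _ (maxn n _) _ (leq_maxl _ _)) H1] [p].
  move=> /(dnS _ (maxn n p) _ (leq_maxr _ _)); have := H1 p; lra.
have [y yd hy] : exists2 y, `|y| <= d & forall n, `|h n y| <= d.
  apply: contrapT => /forall2NP nex.
  have cover y : y \in `[- d, d] -> ~ dn_set y -> up_set y.
    rewrite in_itv /= -ler_norml => yd ndn.
    case: (nex y) => // /existsNP[n /negP].
    rewrite -ltNge ltr_normr => /orP[|dh]; first by exists n.
    by case: ndn; exists n; lra.
  (* One iterate is needed: the endpoint starts at height exactly [d], and escape requires a strict
     inequality. *)
  have upd : up_set d by exists 1%N; apply: up.
  have dnd : dn_set (- d) by exists 1%N; apply: dn.
  (* Inside the segment, [up_set] is open, and closed as the trace of the complement of [dn_set]. It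
     contains [d], so it would be the whole segment, although [- d] escapes downwards. *)
  have E : [set` `[- d, d]] `&` up_set = [set` `[- d, d]].
    apply: (@segment_connected _ (- d) d).
    - by exists d; split=> //=; rewrite in_itv /= lexx andbT; lra.
    - by exists up_set.
    - exists (~` dn_set); first exact: open_closedC.
      by apply/seteqP; split=> y [yI H]; split=> //; [move=> /(disj _ H)|exact: cover].
  suff : [set` `[- d, d]] (- d) by rewrite -E => -[_ /disj /(_ dnd)].
  by rewrite /= in_itv /= lexx; lra.
(* Truncation does nothing inside the square, so both orbits agree as long as they stay there; [hy]
   bounds the second coordinate and [saddle_block] then bounds the first. *)
exists y => j; have [] : iter j S (x, y) = iter j T (x, y) /\ `|iter j S (x, y)| <= d.
  elim: j => [|j [IH1 IH2]]; first by split=> //=; rewrite norm_pair_le xd.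
  have SE : S (iter j S (x, y)) = T (iter j S (x, y)) by rewrite /S /= clamp2_id.
  split; rewrite iterS SE; first by rewrite IH1.
  have := hy j.+1; rewrite /h iterS SE => hj.
  by rewrite norm_pair_le hj andbT; exact: (saddle_block sT).
by move=> ->.
Unshelve. all: by end_near. Qed.

Lemma saddle_stable_graph (R : realType) (d c : R) m (T : R * R -> R * R) :
  saddle d c m T -> exists phi : R -> R,
    (1 : R).-lipschitz_`[- d, d] phi /\
    stable_set T [set z | `|z| <= d] = [set (x, phi x) | x in `[- d, d]].
Proof.
move=> sT; set N := [set z : R * R | `|z| <= d].
have stable_cone a b : stable_set T N a -> stable_set T N b ->
    `|a.1 - b.1| <= `|a.2 - b.2| -> a = b.
  move=> [_ Na ca] [_ Nb cb] ab.
  have cone := saddle_cone_iter sT Na Nb ab.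
  (* The vertical distance of the two orbits never falls below its initial value, yet both orbits
     tend to 0. *)
  have ab2 : `|a.2 - b.2| <= 0.
    apply/ler_addgt0Pl => e e0; rewrite addr0.
    have e20 : 0 < e / 2 by rewrite divr_gt0.
    have [j /=] : exists j,
        `|0 - iter j T a| < e / 2 /\ `|0 - iter j T b| < e / 2.
      move/cvgrPdist_lt : ca => /(_ _ e20) [n1 _ H1].
      move/cvgrPdist_lt : cb => /(_ _ e20) [n2 _ H2].
      exists (maxn n1 n2).
      by split; [apply: H1; rewrite /= leq_maxl | apply: H2; rewrite /= leq_maxr].
    rewrite !sub0r !normrN => -[Ha Hb].
    apply: (le_trans (proj2 (cone j))); apply: (le_trans (ler_normB _ _)).
    have := norm_snd_le (iter j T a); have := norm_snd_le (iter j T b); lra.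
  have ab1 := le_trans ab ab2.
  move: ab1 ab2; rewrite !normr_le0 !subr_eq0 => /eqP ? /eqP ?.
  by rewrite [a]surjective_pairing [b]surjective_pairing; congr pair.
have ex x : `|x| <= d -> exists y, stable_set T N (x, y).
  move=> xd; have [y Ny] := saddle_confined_exists sT xd.
  by exists y; split=> //; [exact: (Ny 0) | exact: saddle_confined_cvg sT Ny].
(* The default value 0 is taken only outside [[- d, d]]. *)
pose phi x := xget 0 [set y | stable_set T N (x, y)].
have phiP x : `|x| <= d -> stable_set T N (x, phi x).
  by move=> /ex [y Hy]; rewrite /phi; case: xgetP => [z _ //|/(_ y)]; tauto.
exists phi; split.
  move=> [x y] [] /=; rewrite !in_itv /= -!ler_norml mul1r => xd yd.
  rewrite leNgt; apply/negP => xy.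
  have [] := stable_cone _ _ (phiP _ xd) (phiP _ yd) (ltW xy).
  by move=> _ exy; move: xy; rewrite exy subrr normr0 normr_lt0.
apply/seteqP; split=> [[x y] Sxy|_ [x /= + <-]]; last first.
  by rewrite in_itv /= -ler_norml => /phiP.
have xd : `|x| <= d by case: Sxy => Nxy _ _; exact: le_trans (norm_fst_le (x, y)) Nxy.
exists x; first by rewrite /= in_itv /= -ler_norml.
(* Two points with the same abscissa satisfy the cone condition trivially, hence coincide. *)
by apply: stable_cone => //=; [exact: phiP | rewrite subrr normr0].
Qed.

(** * Saddles and their inverses *)

Lemma subrBACA (V : zmodType) (u x v y : V) :
  (u - x) - (v - y) = (u - v) - (x - y).
Proof. by rewrite opprD addrACA -opprD. Qed.

(* The strict clause, used contrapositively, shows that the inverse map preserves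
   the horizontal cone. *)
Record weak_saddle (R : realType) (r c : R) (m : nat) (F : R * R -> R * R) : Prop :=
  WeakSaddle {
  weak_saddle_gt0 : 0 < c;
  weak_saddle0 : F 0 = 0;
  weak_saddle_near_id : forall a b, `|a| <= r -> `|b| <= r ->
    `|(F a - a) - (F b - b)| <= `|a - b| / 4;
  weak_saddle_vert : forall a b, `|a| <= r -> `|b| <= r ->
    `|a.1 - b.1| <= `|a.2 - b.2| ->
    `|(F a).1 - (F b).1| <= `|a.2 - b.2| <= `|(F a).2 - (F b).2|;
  weak_saddle_hor : forall a b, `|a| <= r -> `|b| <= r ->
    `|a.2 - b.2| <= `|a.1 - b.1| ->
    `|(F a).1 - (F b).1| <= `|a.1 - b.1|;
  weak_saddle_strict : forall a b, `|a| <= r -> `|b| <= r ->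
    `|a.1 - b.1| < `|a.2 - b.2| -> `|(F a).1 - (F b).1| < `|a.2 - b.2|;
  weak_saddle_expand : forall a, `|a| <= r -> `|a.1| <= `|a.2| ->
    `|a.2| + c * `|a.2| ^+ m <= `|(F a).2|;
  weak_saddle_contract : forall a, `|a| <= r -> `|a.2| <= `|a.1| ->
    `|(F a).1| <= `|a.1| - c * `|a.1| ^+ m }.

Lemma weak_saddle_saddle (R : realType) (d r c : R) m F :
  0 < d -> d <= r -> weak_saddle r c m F -> saddle d c m F.
Proof.
move=> d0 dr sF; have inr (a : R * R) : `|a| <= d -> `|a| <= r by move=> /le_trans; apply.
have r0 : `|(0 : R * R)| <= r by rewrite normr0 (le_trans (ltW d0)).
split=> //.
- exact: weak_saddle_gt0 sF.
- move=> a b /inr ar /inr br; have := weak_saddle_near_id sF ar br.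
  have -> : F a - F b = ((F a - a) - (F b - b)) + (a - b).
    by rewrite subrBACA subrK.
  by have := ler_normD (F a - a - (F b - b)) (a - b); have := normr_ge0 (a - b); lra.
- move=> a /inr ar; have := weak_saddle_near_id sF ar r0.
  by rewrite (weak_saddle0 sF) !subr0; have := normr_ge0 a; lra.
- move=> a b /inr ar /inr br ab.
  have /andP[H1 H2] := weak_saddle_vert sF ar br ab.
  by split=> //; exact: le_trans H2.
- by move=> a /inr ar; exact: (weak_saddle_expand sF).
- by move=> a /inr ar ya _; exact: (weak_saddle_contract sF).
(* Comparison with the fixed point 0 bounds the first coordinate of the image by the larger
   coordinate of [a], in either cone. *)
- move=> a ad _; have ar := inr _ ad.
  have [xy|/ltW yx] := lerP `|a.1| `|a.2|.
    have := weak_saddle_vert sF ar r0; rewrite (weak_saddle0 sF) !subr0.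
    by move=> /(_ xy) /andP[/le_trans + _]; apply; apply: le_trans ad; exact: norm_snd_le.
  have := weak_saddle_hor sF ar r0; rewrite (weak_saddle0 sF) !subr0.
  by move=> /(_ yx) /le_trans; apply; apply: le_trans ad; exact: norm_fst_le.
Qed.

(** The inverse map expands the first coordinate; conjugation by [swap] makes the second one
    expanding, as [saddle] requires. *)
Definition swap (R : realType) (z : R * R) : R * R := (z.2, z.1).
Arguments swap {R} z.

Lemma norm_swap (R : realType) (z : R * R) : `|swap z| = `|z|.
Proof. by rewrite !prod_normE maxC. Qed.

(** Contraction of [F] at [G a] becomes expansion of [G] at [a], and conversely. The gain or loss is
    then expressed at [G a] instead of [a]; the relevant coordinate of [G a] is at least half that
    of [a], whence the factor [2 ^+ m]. *)
Lemma weak_saddle_inv_saddle (R : realType) (d r c : R) m (F G : R * R -> R * R) :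
  0 < d -> d <= r -> weak_saddle r c m F ->
  (forall w, `|w| <= d -> `|G w| <= r /\ F (G w) = w) ->
  saddle d (c / 2 ^+ m) m (swap \o G \o swap).
Proof.
move=> d0 dr sF GF; have c0 := weak_saddle_gt0 sF.
have r0 : `|(0 : R * R)| <= r by rewrite normr0 (le_trans (ltW d0)).
have F0 := weak_saddle0 sF.
have near a : `|a| <= d -> `|G a - a| <= `|G a| / 4.
  move=> /GF [Gr FG]; have := weak_saddle_near_id sF Gr r0.
  by rewrite F0 FG !subr0 distrC.
have vert a b : `|a| <= d -> `|b| <= d -> `|a.2 - b.2| <= `|a.1 - b.1| ->
    `|(G a).2 - (G b).2| <= `|(G a).1 - (G b).1| /\
    `|a.1 - b.1| <= `|(G a).1 - (G b).1|.
  move=> /GF [ar Fa] /GF [br Fb] ab.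
  have le21 : `|(G a).2 - (G b).2| <= `|(G a).1 - (G b).1|.
    rewrite leNgt; apply/negP => lt12.
    have := weak_saddle_strict sF ar br lt12.
    have /andP[_] := weak_saddle_vert sF ar br (ltW lt12).
    by rewrite Fa Fb; lra.
  by split=> //; have := weak_saddle_hor sF ar br le21; rewrite Fa Fb.
have G0 : G 0 = 0.
  have := near 0; rewrite normr0 subr0 => /(_ (ltW d0)) H.
  by apply/eqP; rewrite -normr_le0; lra.
have d0' : `|(0 : R * R)| <= d by rewrite normr0 ltW.
have p2 : 1 <= (2 : R) ^+ m by rewrite exprn_ege1// ler1n.
have cc : c / 2 ^+ m <= c by rewrite ler_pdivrMr ?ler_peMr// ?(ltW c0)// (lt_le_trans ltr01).
split=> //.
- by rewrite divr_gt0// exprn_gt0.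
- move=> a b; rewrite -(norm_swap a) -(norm_swap b) => ad bd.
  have [ar Fa] := GF _ ad; have [br Fb] := GF _ bd.
  have := weak_saddle_near_id sF ar br; rewrite Fa Fb.
  have -> : `|a - b| = `|swap a - swap b| by rewrite -norm_swap.
  have -> : `|(swap \o G \o swap) a - (swap \o G \o swap) b| =
            `|G (swap a) - G (swap b)| by rewrite -[RHS]norm_swap.
  set u := swap a; set v := swap b => H.
  (* The increment of [G] occurs on both sides; absorbing a quarter of it leaves the Lipschitz
     constant 4/3, below 2. *)
  have := ler_normB (u - v) (u - G u - (v - G v)).
  have -> : u - v - (u - G u - (v - G v)) = G u - G v.
    by rewrite subrBACA !subKr.
  by have := normr_ge0 (u - v); have := normr_ge0 (G u - G v); lra.
- move=> a; rewrite -(norm_swap a) => /near.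
  have -> : `|(swap \o G \o swap) a - a| = `|G (swap a) - swap a| by rewrite -norm_swap.
  set u := swap a => H; have := ler_normD (G u - u) u; rewrite subrK.
  by have := normr_ge0 u; have := normr_ge0 (G u); lra.
- by move=> a b; rewrite -(norm_swap a) -(norm_swap b) => ad bd /= /(vert _ _ ad bd).
- move=> a; rewrite -(norm_swap a); case: a => y x /= ad yx.
  have := vert _ _ ad d0'; rewrite G0 /= !subr0 => /(_ yx) [le21 ge].
  have [ar Fa] := GF _ ad; have := weak_saddle_contract sF ar le21; rewrite Fa /=.
  suff : c / 2 ^+ m * `|x| ^+ m <= c * `|(G (x, y)).1| ^+ m by rewrite /swap/=; lra.
  by rewrite ler_pM ?exprn_ge0 ?divr_ge0 ?exprn_ge0 ?(ltW c0)// lerXn2r// nnegrE.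
- move=> a; rewrite -(norm_swap a); case: a => y x /= ad xy.
  rewrite /swap /= => le12; have [ar Fa] := GF _ ad.
  have := weak_saddle_expand sF ar le12; rewrite Fa /=.
  (* Since [G (x, y)] lies in the vertical cone, its norm is that of its second coordinate, and
     [near] gives [|y|] at most 5/4 of it. *)
  suff : c / 2 ^+ m * `|y| ^+ m <= c * `|(G (x, y)).2| ^+ m by lra.
  rewrite -mulrA ler_pM2l// -exprVn -exprMn lerXn2r ?nnegrE ?mulr_ge0 ?invr_ge0//.
  have := near _ ad; rewrite [`|G _|]prod_normE (max_r le12).
  move=> /(le_trans (norm_snd_le _)) /=.
  have := ler_normB (G (x, y)).2 ((G (x, y)).2 - y); rewrite opprB addrCA subrr addr0.
  by have := normr_ge0 (G (x, y)).2; lra.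
- move=> a; rewrite -(norm_swap a); case: a => y x; rewrite /swap /= => ad x1.
  (* If the second coordinate of [G (x, y)] exceeded [d], this point would lie in the vertical cone,
     where [F] does not decrease that coordinate; but its image [(x, y)] is in the square. *)
  have [ar Fa] := GF _ ad; rewrite leNgt; apply/negP => dy.
  have := weak_saddle_vert sF ar r0; rewrite F0 !subr0.
  move=> /(_ (ltW (le_lt_trans x1 dy))) /andP[_]; rewrite Fa /= => H.
  by have := le_trans H (le_trans (norm_snd_le (x, y)) ad); lra.
Qed.

(** * Local surjectivity by contraction *)

HB.instance Definition _ (U V : pnbhsType) := Pointed.on (U * V)%type.
HB.instance Definition _ (U V : puniformType) := Pointed.on (U * V)%type.

(** Both projections of a Cauchy filter converge. Completeness of the product lets the Banach fixed
    point theorem be applied in the plane. *)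
Lemma prod_complete (R : numFieldType) (U V : completePseudoMetricType R)
    (F : set_system (U * V)) : ProperFilter F -> cauchy F -> cvg F.
Proof.
move=> FF /cauchy_ballP F_cauchy.
have /cauchy_cvg/cvg_ex[u Fu] : cauchy (fst @ F).
  apply/cauchy_ballP => e e0; rewrite near_map2.
  by have := F_cauchy _ e0; apply: filterS => -[[? ?] [? ?]] [].
have /cauchy_cvg/cvg_ex[v Fv] : cauchy (snd @ F).
  apply/cauchy_ballP => e e0; rewrite near_map2.
  by have := F_cauchy _ e0; apply: filterS => -[[? ?] [? ?]] [].
apply/cvg_ex; exists (u, v).
apply: cvg_trans (cvg_pair Fu Fv) => A.
by apply: (@filterS _ F) => -[].
Qed.

HB.instance Definition _ (R : numFieldType) (U V : completePseudoMetricType R) :=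
  Uniform_isComplete.Build (U * V)%type (@prod_complete R U V).
HB.instance Definition _ (R : numFieldType) (U V : completeNormedModType R) :=
  Complete.on (U * V)%type.

Lemma contraction_fixpoint (R : realType) (V : completeNormedModType R)
    (f : V -> V) (q : R) : 0 <= q < 1 ->
  (forall a b, `|f a - f b| <= q * `|a - b|) -> exists z, f z = z.
Proof.
move=> /andP[q0 q1] fq.
have fS : {homo f : x / [set: V] x >-> [set: V] x} by [].
pose g := mkfun fS.
have gc : is_contraction g.
  by exists (NngNum q0); split=> // -[a b] _; exact: fq.
by have [z _ zE] := banach_fixed_point gc closedT (ex_intro _ 0 I); exists z.
Qed.

(** The equation [F z = w] says that [z] is a fixed point of [z => w - (F z - z)], which contracts
    by 1/4 on the square of radius [r]; truncation makes this contraction global. *)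
Lemma near_id_surj (R : realType) (r : R) (F : R * R -> R * R) : 0 < r ->
  F 0 = 0 ->
  (forall a b, `|a| <= r -> `|b| <= r ->
    `|(F a - a) - (F b - b)| <= `|a - b| / 4) ->
  forall w, `|w| <= r / 2 -> exists2 z, `|z| <= 2 * `|w| & F z = w.
Proof.
move=> r0 F0 Fq w wr; pose E z := F z - z.
have cN z : `|clamp2 r z| <= r by apply: clamp2_norm; exact: ltW.
have [|a b|z] := @contraction_fixpoint R (R * R)%type
    (fun z => w - E (clamp2 r z)) (1 / 4).
- by lra.
- have -> : w - E (clamp2 r a) - (w - E (clamp2 r b)) = E (clamp2 r b) - E (clamp2 r a).
    by rewrite subrBACA subrr sub0r opprB.
  rewrite distrC.
  apply: le_trans (Fq _ _ (cN a) (cN b)) _; rewrite div1r [leRHS]mulrC ler_pM2r ?invr_gt0//.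
  exact: clamp2_lip.
have Er z' : `|z'| <= r -> `|E z'| <= `|z'| / 4.
  move=> zr; have := Fq _ 0 zr; rewrite F0 normr0 !subr0; apply; exact: ltW.
move=> zE; have := ler_normB w (E (clamp2 r z)); rewrite zE => zle.
(* The fixed point has norm at most [r / 2 + r / 4], so the truncation can be removed. *)
have zr : `|z| <= r by have := Er _ (cN z); have := cN z; lra.
move: zE zle; rewrite clamp2_id// => zE zle; exists z.
  by have := Er _ zr; have := normr_ge0 z; lra.
by rewrite -[LHS](subrK z) -/(E z) -[in X in _ + X]zE addrC subrK.
Qed.

(** * Saddles from bounds on partial derivatives *)

Definition segment_point (R : realType) (a b : R * R) (t : R) : R * R :=
  b + t *: (a - b).

Lemma segment_point_norm (R : realType) (a b : R * R) (t r : R) :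
  `|a| <= r -> `|b| <= r -> 0 < t < 1 -> `|segment_point a b t| <= r.
Proof.
move=> ar br /andP[t0 t1].
have -> : segment_point a b t = (1 - t) *: b + t *: a.
  by rewrite /segment_point scalerBr scalerBl scale1r addrCA addrC.
apply: le_trans (ler_normD _ _) _; rewrite !normrZ (gtr0_norm t0) ger0_norm; last lra.
have -> : r = (1 - t) * r + t * r by ring.
by rewrite lerD// ler_wpM2l//; lra.
Qed.

(** On the outer half of the segment from 0 to [a], the intermediate point of the mean value theorem
    stays away from 0, which makes the lower bound on the derivatives quantitative. *)
Lemma segment_point_half (R : realType) (a : R * R) (t : R) :
  0 < t -> `|a| / 2 <= `|segment_point a (2^-1 *: a) t|.
Proof.
move=> t0; have -> : segment_point a (2^-1 *: a) t = (2^-1 * (1 + t)) *: a.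
  rewrite /segment_point -{2}(scale1r a) -scalerBl scalerA -scalerDl.
  by congr (_ *: _); field.
rewrite normrZ mulrC ler_wpM2r// ger0_norm; last by rewrite mulr_ge0//; lra.
lra.
Qed.

Lemma norm_lin2_le (R : realType) (u v x y : R) :
  `|u * x + v * y| <= `|u| * `|x| + `|v| * `|y|.
Proof. by apply: le_trans (ler_normD _ _) _; rewrite !normrM. Qed.

Lemma norm_lin2_ge (R : realType) (u v x y : R) :
  `|u| * `|x| - `|v| * `|y| <= `|u * x + v * y|.
Proof.
rewrite lerBlDr -!normrM; have := ler_normB (u * x + v * y) (v * y).
by rewrite addrK.
Qed.

(** The weights [1 - u] and [v] have sum at most 1. Here [u] stands for the diagonal derivative and
    [v] for the absolute value of the off-diagonal one. *)
Lemma contracted_le (R : realType) (u v x y : R) :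
  0 <= v -> v <= u -> u <= 8^-1 -> x <= y -> 0 <= y ->
  (1 - u) * x + v * y <= y.
Proof.
move=> v0 vu u8 xy y0; have H1 : (1 - u) * x <= (1 - u) * y by rewrite ler_wpM2l//; lra.
have : v * y <= u * y by rewrite ler_wpM2r.
lra.
Qed.

Lemma contracted_lt (R : realType) (u v x y : R) :
  0 <= v -> v <= u -> u <= 8^-1 -> x < y -> 0 <= y ->
  (1 - u) * x + v * y < y.
Proof.
move=> v0 vu u8 xy y0; have H1 : (1 - u) * x < (1 - u) * y by rewrite ltr_pM2l//; lra.
have : v * y <= u * y by rewrite ler_wpM2r.
lra.
Qed.

Lemma expanded_ge (R : realType) (u v x y : R) :
  0 <= v -> v <= u -> x <= y -> 0 <= y -> y <= (1 + u) * y - v * x.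
Proof.
move=> v0 vu xy y0; have : v * x <= v * y by rewrite ler_wpM2l.
have : v * y <= u * y by rewrite ler_wpM2r.
lra.
Qed.

(** The two components have different intermediate points, so each is estimated separately with its
    own dominant diagonal entry. In the constant [c / 2 ^+ m.+1], the factor [2 ^+ m] comes from an
    intermediate point of norm at least [|a| / 2], and the last 2 from using only half of the
    displacement. *)
Lemma weak_saddle_of_gradient (R : realType) (r c : R) m (F : R * R -> R * R)
    (p11 p12 q21 q22 : R * R -> R) :
  0 < c -> F 0 = 0 ->
  (forall a b, exists2 t, 0 < t < 1 & (F a).1 - (F b).1 =
    (1 - p11 (segment_point a b t)) * (a.1 - b.1) -
    p12 (segment_point a b t) * (a.2 - b.2)) ->
  (forall a b, exists2 t, 0 < t < 1 & (F a).2 - (F b).2 =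
    (1 + q22 (segment_point a b t)) * (a.2 - b.2) +
    q21 (segment_point a b t) * (a.1 - b.1)) ->
  (forall z, `|z| <= r -> `|p12 z| + c * `|z| ^+ m <= p11 z <= 8^-1) ->
  (forall z, `|z| <= r -> `|q21 z| + c * `|z| ^+ m <= q22 z <= 8^-1) ->
  weak_saddle r (c / 2 ^+ m.+1) m.+1 F.
Proof.
move=> c0 F0 mvt1 mvt2 hp hq.
have cz z : 0 <= c * `|z : R * R| ^+ m by rewrite mulr_ge0 ?exprn_ge0// ltW.
have fst_diff a b : `|a| <= r -> `|b| <= r -> exists u v, [/\ `|v| <= u, u <= 8^-1 &
    (F a).1 - (F b).1 = (1 - u) * (a.1 - b.1) + v * (a.2 - b.2)].
  move=> ar br; have [t t01 E] := mvt1 a b.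
  have := hp _ (segment_point_norm ar br t01); move: E; set z := segment_point _ _ _.
  move=> E /andP[H1 H2]; exists (p11 z), (- p12 z); split=> //.
    by rewrite normrN; have := cz z; lra.
  by rewrite E mulNr.
have snd_diff a b : `|a| <= r -> `|b| <= r -> exists u v, [/\ `|v| <= u, u <= 8^-1 &
    (F a).2 - (F b).2 = (1 + u) * (a.2 - b.2) + v * (a.1 - b.1)].
  move=> ar br; have [t t01 E] := mvt2 a b.
  have := hq _ (segment_point_norm ar br t01); move: E; set z := segment_point _ _ _.
  move=> E /andP[H1 H2]; exists (q22 z), (q21 z); split=> //.
  by have := cz z; lra.
have half (a : R * R) : `|a| <= r -> `|2^-1 *: a| <= r.
  by move=> ar; rewrite normrZ ger0_norm ?invr_ge0//; have := normr_ge0 a; lra.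
have r0 (a : R * R) : `|a| <= r -> `|(0 : R * R)| <= r.
  by rewrite normr0; exact: le_trans.
have pow (a z : R * R) (x : R) : `|a| = x -> `|a| / 2 <= `|z| ->
    c / 2 ^+ m * x ^+ m <= c * `|z| ^+ m.
  move=> <- az; rewrite -mulrA ler_pM2l// -exprVn -exprMn mulrC.
  by rewrite lerXn2r// nnegrE// divr_ge0.
split=> //.
- by rewrite divr_gt0// exprn_gt0.
- move=> a b ar br; rewrite norm_pair_le /=; apply/andP; split.
    have [u [v [vu u8 E]]] := fst_diff _ _ ar br.
    have -> : (F a).1 - a.1 - ((F b).1 - b.1) = (- u) * (a.1 - b.1) + v * (a.2 - b.2).
      by rewrite subrBACA E; ring.
    apply: le_trans (norm_lin2_le _ _ _ _) _; rewrite normrN (ger0_norm (le_trans _ vu))//.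
  have -> : `|a - b| / 4 = 8^-1 * `|a - b| + 8^-1 * `|a - b| by field.
  have v8 := le_trans vu u8; have u0 := le_trans (normr_ge0 v) vu.
  by rewrite lerD// ler_pM// ?(norm_fst_le (a - b))// (norm_snd_le (a - b)).
  have [u [v [vu u8 E]]] := snd_diff _ _ ar br.
  have -> : (F a).2 - a.2 - ((F b).2 - b.2) = u * (a.2 - b.2) + v * (a.1 - b.1).
    by rewrite subrBACA E; ring.
  apply: le_trans (norm_lin2_le _ _ _ _) _; rewrite (ger0_norm (le_trans _ vu))//.
  have -> : `|a - b| / 4 = 8^-1 * `|a - b| + 8^-1 * `|a - b| by field.
  have v8 := le_trans vu u8; have u0 := le_trans (normr_ge0 v) vu.
  by rewrite lerD// ler_pM// ?(norm_fst_le (a - b))// (norm_snd_le (a - b)).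
- move=> a b ar br ab; have [u [v [vu u8 ->]]] := fst_diff _ _ ar br.
  have [u' [v' [vu' u8' ->]]] := snd_diff _ _ ar br; apply/andP; split.
    apply: le_trans (norm_lin2_le _ _ _ _) _; rewrite ger0_norm; last lra.
    exact: contracted_le.
  apply: le_trans (norm_lin2_ge _ _ _ _); rewrite [`|1 + _|]ger0_norm.
    exact: expanded_ge.
  by have := normr_ge0 v'; lra.
- move=> a b ar br ab; have [u [v [vu u8 ->]]] := fst_diff _ _ ar br.
  apply: le_trans (norm_lin2_le _ _ _ _) _; rewrite ger0_norm; last lra.
  apply: le_trans (contracted_le (normr_ge0 v) vu u8 (lexx _) (normr_ge0 _)).
  by rewrite lerD2l ler_wpM2l.
- move=> a b ar br ab; have [u [v [vu u8 ->]]] := fst_diff _ _ ar br.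
  apply: le_lt_trans (norm_lin2_le _ _ _ _) _; rewrite ger0_norm; last lra.
  exact: contracted_lt.
(* Half of the displacement from 0 to [a] happens at norm at least |a| / 2. *)
- move=> a ar xy; have na : `|a| = `|a.2| by rewrite prod_normE max_r.
  have [u [v [vu u8 E]]] := snd_diff _ _ (half _ ar) (r0 _ ar).
  have [t /andP[t0 t1] E'] := mvt2 a (2^-1 *: a).
  have := hq _ (segment_point_norm ar (half _ ar) (introT andP (conj t0 t1))).
  move: (segment_point_half a t0) E'; set z := segment_point _ _ _ => /(pow _ _ _ na).
  move=> pz E' /andP[H1 H2].
  (* Sum of the increments from 0 to [a / 2] and from [a / 2] to [a]: the first uses only diagonal
     dominance, the second supplies the gain of higher order. *)
  have -> : (F a).2 = ((1 + u) / 2 + (1 + q22 z) / 2) * a.2 + (v / 2 + q21 z / 2) * a.1.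
    rewrite -[LHS](subrK (F (2^-1 *: a)).2) E' -[(F (2^-1 *: a)).2]subr0.
    by have := E; rewrite F0 /= !subr0 => ->; rewrite /GRing.scale /=; field.
  apply: le_trans (norm_lin2_ge _ _ _ _).
  have Hw : `|v / 2 + q21 z / 2| <= `|v| / 2 + `|q21 z| / 2.
    by apply: le_trans (ler_normD _ _) _; rewrite !normrM !normfV normr_nat.
  have -> : c / 2 ^+ m.+1 * `|a.2| ^+ m.+1 = (c / 2 ^+ m * `|a.2| ^+ m) / 2 * `|a.2|.
    by rewrite !exprS invfM; field; rewrite expf_neq0.
  have cz0 := cz z; rewrite [`|_ / 2 + _ / 2|]ger0_norm; last first.
    by have := normr_ge0 v; have := normr_ge0 (q21 z); lra.
  have : `|v / 2 + q21 z / 2| * `|a.1| <= (`|v| / 2 + `|q21 z| / 2) * `|a.2| by rewrite ler_pM.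
  have : `|v| * `|a.2| <= u * `|a.2| by rewrite ler_wpM2r.
  have : (`|q21 z| + c / 2 ^+ m * `|a.2| ^+ m) * `|a.2| <= q22 z * `|a.2|.
    by rewrite ler_wpM2r//; lra.
  lra.
- move=> a ar yx; have na : `|a| = `|a.1| by rewrite prod_normE max_l.
  have [u [v [vu u8 E]]] := fst_diff _ _ (half _ ar) (r0 _ ar).
  have [t /andP[t0 t1] E'] := mvt1 a (2^-1 *: a).
  have := hp _ (segment_point_norm ar (half _ ar) (introT andP (conj t0 t1))).
  move: (segment_point_half a t0) E'; set z := segment_point _ _ _ => /(pow _ _ _ na).
  move=> pz E' /andP[H1 H2].
  have -> : (F a).1 = ((1 - u) / 2 + (1 - p11 z) / 2) * a.1 + (v / 2 - p12 z / 2) * a.2.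
    rewrite -[LHS](subrK (F (2^-1 *: a)).1) E' -[(F (2^-1 *: a)).1]subr0.
    by have := E; rewrite F0 /= !subr0 => ->; rewrite /GRing.scale /=; field.
  apply: le_trans (norm_lin2_le _ _ _ _) _.
  have Hw : `|v / 2 - p12 z / 2| <= `|v| / 2 + `|p12 z| / 2.
    by apply: le_trans (ler_normB _ _) _; rewrite !normrM !normfV normr_nat.
  have -> : c / 2 ^+ m.+1 * `|a.1| ^+ m.+1 = (c / 2 ^+ m * `|a.1| ^+ m) / 2 * `|a.1|.
    by rewrite !exprS invfM; field; rewrite expf_neq0.
  have cz0 := cz z; rewrite [`|_ / 2 + _ / 2|]ger0_norm; last lra.
  have : `|v / 2 - p12 z / 2| * `|a.2| <= (`|v| / 2 + `|p12 z| / 2) * `|a.1|.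
    by rewrite ler_pM.
  have : `|v| * `|a.1| <= u * `|a.1| by rewrite ler_wpM2r.
  have : (`|p12 z| + c / 2 ^+ m * `|a.1| ^+ m) * `|a.1| <= p11 z * `|a.1|.
    by rewrite ler_wpM2r//; lra.
  lra.
Qed.

(** * Partial derivatives and the mean value theorem *)

(** The differential as an explicit linear form, so that the rules of calculus become identities
    between pairs of numbers. *)
Definition has_gradient (R : realType) (f : R * R -> R) (z : R * R) (u v : R) :=
  differentiable f z /\ forall w, 'd f z w = u * w.1 + v * w.2.

Lemma has_gradient_partial (R : realType) (f : R * R -> R) z :
  differentiable f z -> has_gradient f z (partial_x f z) (partial_y f z).
Proof.
move=> df; split=> // w; rewrite /partial_x /partial_y !deriveE//.
have E : w = w.1 *: ((1, 0) : R * R) + w.2 *: ((0, 1) : R * R).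
  rewrite [RHS]surjective_pairing [LHS]surjective_pairing /=.
  by congr pair; rewrite /GRing.scale /= !mulr1 !mulr0 ?addr0 ?add0r.
by rewrite {1}E linearD !linearZ /= /GRing.scale /= mulrC [_ * w.2]mulrC.
Qed.

Lemma has_gradient_cst (R : realType) (k : R) z : has_gradient (fun _ => k) z 0 0.
Proof. by split=> [|w]; [exact: differentiable_cst | rewrite diff_cst !mul0r addr0]. Qed.

Lemma has_gradient_fst (R : realType) z : has_gradient (@fst R R) z 1 0.
Proof.
have cf : continuous (@fst R R) by move=> ?; exact: cvg_fst.
by split=> [|w]; [exact: linear_differentiable | rewrite diff_lin//= mul1r mul0r addr0].
Qed.

Lemma has_gradient_snd (R : realType) z : has_gradient (@snd R R) z 0 1.
Proof.
have cf : continuous (@snd R R) by move=> ?; exact: cvg_snd.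
by split=> [|w]; [exact: linear_differentiable | rewrite diff_lin//= mul1r mul0r add0r].
Qed.

Lemma has_gradientD (R : realType) (f g : R * R -> R) z u v u' v' :
  has_gradient f z u v -> has_gradient g z u' v' ->
  has_gradient (fun z => f z + g z) z (u + u') (v + v').
Proof.
move=> [df fE] [dg gE]; split=> [|w]; first exact: differentiableD.
apply: etrans (congr1 (fun d : R * R -> R => d w) (diffD df dg)) _.
apply: etrans (congr2 +%R (fE w) (gE w)) _; ring.
Qed.

Lemma has_gradientN (R : realType) (f : R * R -> R) z u v :
  has_gradient f z u v -> has_gradient (fun z => - f z) z (- u) (- v).
Proof.
move=> [df fE]; split=> [|w]; first exact: differentiableN.
apply: etrans (congr1 (fun d : R * R -> R => d w) (diffN df)) _.
apply: etrans (congr1 -%R (fE w)) _; ring.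
Qed.

Lemma has_gradientM (R : realType) (f g : R * R -> R) z u v u' v' :
  has_gradient f z u v -> has_gradient g z u' v' ->
  has_gradient (fun z => f z * g z) z (u * g z + f z * u') (v * g z + f z * v').
Proof.
move=> [df fE] [dg gE]; split=> [|w]; first exact: differentiableM.
apply: etrans (congr1 (fun d : R * R -> R => d w) (diffM df dg)) _.
apply: etrans (congr2 +%R (congr1 ( *%R (f z)) (gE w)) (congr1 ( *%R (g z)) (fE w))) _; ring.
Qed.

Lemma planar_MVT (R : realType) (f fx fy : R * R -> R) :
  (forall z, has_gradient f z (fx z) (fy z)) ->
  forall a b, exists2 t, 0 < t < 1 & f a - f b =
    fx (segment_point a b t) * (a.1 - b.1) + fy (segment_point a b t) * (a.2 - b.2).
Proof.
move=> gf a b; pose h t := f (segment_point a b t).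
have hd (t : R) : is_derive t (1 : R) h ('d f (segment_point a b t) (a - b)).
  have [df _] := gf (segment_point a b t).
  (* The difference quotients of [h] are those of [f] in the direction [a - b], so [h] inherits its
     derivative from the differential of [f]. *)
  have E : (fun s => s^-1 *: ((h \o shift t) (s *: (1 : R)) - h t)) =
    (fun s => s^-1 *: ((f \o shift (segment_point a b t)) (s *: (a - b)) -
                       f (segment_point a b t))).
    apply/funext => s; congr (_ *: (f _ - _)); rewrite /segment_point /=.
    by rewrite -[s *: 1]/(s * 1) mulr1 scalerDl addrCA.
  have dv : derivable f (segment_point a b t) (a - b) by exact: diff_derivable.
  split; first by rewrite /derivable E.
  by rewrite /derive E -deriveE.
have [|t t01] := @MVT R h _ 0 1 ltr01 (fun t _ => hd t).
  apply: derivable_within_continuous => t _; exact: ex_derive.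
have h1 : h 1 = f a by rewrite /h /segment_point scale1r addrC subrK.
have h0 : h 0 = f b by rewrite /h /segment_point scale0r addr0.
rewrite h1 h0 subr0 mulr1 => E.
exists t; first by move: t01; rewrite in_itv.
by rewrite E; have [_ ->] := gf (segment_point a b t).
Qed.

(** * Gradients of polynomial functions *)

Lemma eval2D (R : realType) (p q : mpolynomial 2 R) z :
  eval2 (p + q) z = eval2 p z + eval2 q z.
Proof. by rewrite /eval2 mpoly.mevalD. Qed.

Lemma eval2B (R : realType) (p q : mpolynomial 2 R) z :
  eval2 (p - q) z = eval2 p z - eval2 q z.
Proof. by rewrite /eval2 mpoly.mevalB. Qed.

Lemma eval2M (R : realType) (p q : mpolynomial 2 R) z :
  eval2 (p * q) z = eval2 p z * eval2 q z.
Proof. by rewrite /eval2 mpoly.mevalM. Qed.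

(** Formal and analytic derivatives agree on constants and indeterminates and obey the same sum and
    product rules; these generate all polynomials. *)
Lemma eval2_gradient (R : realType) (p : mpolynomial 2 R) z :
  has_gradient (eval2 p) z (eval2 (pderiv_x p) z) (eval2 (pderiv_y p) z).
Proof.
pose G p := has_gradient (eval2 p) z (eval2 (pderiv_x p) z) (eval2 (pderiv_y p) z).
have GM p1 p2 : G p1 -> G p2 -> G (p1 * p2).
  move=> /has_gradientM g1 /g1; rewrite /G /pderiv_x /pderiv_y !mpoly.mderivM !eval2D !eval2M.
  by congr has_gradient; apply/funext => w; rewrite eval2M.
have GC c : G (mpoly.mpolyC 2 c).
  rewrite /G /pderiv_x /pderiv_y !mpoly.mderivC /eval2 mpoly.meval0.
  rewrite (_ : (fun _ => _) = fun=> c); first exact: has_gradient_cst.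
  by apply/funext => w; rewrite mpoly.mevalC.
have GX i : G (mpoly.mpolyX R (mpoly.mnm1 i)).
  rewrite /G /pderiv_x /pderiv_y !mpoly.mderivX.
  rewrite !mpoly.mnm1E /eval2 !mpoly.mevalZ !mpoly.mevalX !big_ord_recl !big_ord0.
  rewrite !mpoly.mnmBE !mpoly.mnm1E /=.
  have [->|->] : i = ord0 \/ i = ord_max.
    by case: i => [[|[|//]] ?]; [left|right]; exact: val_inj.
  - rewrite /= mul1r mul0r subnn sub0n !expr0 !mulr1.
    rewrite (_ : (fun z => _) = fst); first exact: has_gradient_fst.
    by apply/funext => w; rewrite mpoly.mevalXU.
  - rewrite (_ : ord_max == ord0 = false)// (_ : ord_max == lift ord0 ord0 = true)//.
    rewrite (_ : ord_max == ord_max = true)//= mul1r mul0r !subnn !expr0 !mulr1.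
    rewrite (_ : (fun z => _) = snd); first exact: has_gradient_snd.
    by apply/funext => w; rewrite mpoly.mevalXU.
elim/mpoly.mpolyind: p => [|c m p _ _ IH]; first by rewrite -[0](mpoly.mpolyC0 2); exact: GC.
have Gm : G (c *: mpoly.mpolyX R m).
  rewrite -mpoly.mul_mpolyC; apply: (GM) => //; rewrite mpoly.mpolyXE_id.
  apply: (big_ind G) => [|x y|i _]; [by rewrite -[1]/(mpoly.mpolyC 2 1); exact: GC | exact: GM |].
  elim: (m i) => [|n IHn]; first by rewrite expr0 -[1]/(mpoly.mpolyC 2 1); exact: GC.
  by rewrite exprS; exact: GM.
move: Gm IH => /has_gradientD g1 /g1.
rewrite /pderiv_x /pderiv_y !mpoly.mderivD !eval2D.
by congr has_gradient; apply/funext => w; rewrite eval2D.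
Qed.

(** * Homogeneous lower bounds *)

Definition row2 (R : realType) (z : R * R) : 'rV[R]_2 :=
  \row_i tnth [tuple z.1; z.2] i.

Lemma eval2_tensor (R : realType) m (p : mpolynomial 2 R) (B : tensor R 2 m) z :
  coef_tensor p B -> eval2 p z = tensor_form B (row2 z).
Proof.
by move=> [_ <-]; apply: mpoly.meval_eq => i; rewrite mxE.
Qed.

Lemma tensor_formZ (R : realType) n m (B : tensor R n m) t x :
  tensor_form B (t *: x) = t ^+ m * tensor_form B x.
Proof.
rewrite /tensor_form mulr_sumr; apply: eq_bigr => s _.
rewrite mulrCA; congr (_ * _).
under eq_bigr do rewrite mxE.
by rewrite big_split /= prodr_const card_ord.
Qed.

(** Homogeneity is read off the tensor form, each term of which has exactly [m] factors. *)
Lemma eval2_homogeneous (R : realType) m (p : mpolynomial 2 R) (B : tensor R 2 m) :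
  coef_tensor p B -> forall t z, eval2 p (t *: z) = t ^+ m * eval2 p z.
Proof.
move=> pB t z; rewrite !(eval2_tensor _ pB) -tensor_formZ; congr tensor_form.
by apply/rowP => -[[|[|//]] ?]; rewrite !mxE.
Qed.

Lemma eval2_gt0 (R : realType) m (p : mpolynomial 2 R) (B : tensor R 2 m) :
  coef_tensor p B -> positive_definite B -> forall z, z != 0 -> 0 < eval2 p z.
Proof.
move=> pB B0 z z0; rewrite (eval2_tensor _ pB); apply: B0.
apply: contra_neq z0 => /rowP zE.
have z1 : z.1 = 0 by have := zE ord0; rewrite !mxE.
have z2 : z.2 = 0 by have := zE ord_max; rewrite !mxE.
by rewrite [z]surjective_pairing z1 z2.
Qed.

Lemma eval2_continuous (R : realType) (p : mpolynomial 2 R) : continuous (eval2 p).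
Proof. by move=> z; apply: differentiable_continuous; have [] := eval2_gradient p z. Qed.

(** By compactness [h] has a positive minimum on the right and top sides of the unit square of the
    maximum norm. Scaling reaches every other nonzero point, the opposite sides included because the
    degree is even. *)
Lemma homogeneous_lower_bound (R : realType) k (h : R * R -> R) :
  (0 < k)%N -> continuous h -> (forall t z, h (t *: z) = t ^+ (2 * k) * h z) ->
  (forall z, z != 0 -> 0 < h z) ->
  exists2 c, 0 < c & forall z, c * `|z| ^+ (2 * k) <= h z.
Proof.
move=> k0 hc hh h0.
have le11 : -1 <= 1 :> R by lra.
have pairc1 : continuous (fun t : R => (1, t) : R * R).
  by move=> t; exact: (cvg_pair (cvg_cst (1 : R)) cvg_id).
have pairc2 : continuous (fun t : R => (t, 1) : R * R).
  by move=> t; exact: (cvg_pair cvg_id (cvg_cst (1 : R))).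
have [|s1 _ m1] := @EVT_min R (fun t => h (1, t)) _ _ le11.
  by apply: continuous_subspaceT => t; exact: (continuous_comp (pairc1 t) (hc _)).
have [|s2 _ m2] := @EVT_min R (fun t => h (t, 1)) _ _ le11.
  by apply: continuous_subspaceT => t; exact: (continuous_comp (pairc2 t) (hc _)).
have h1 : 0 < h (1, s1) by apply: h0; rewrite xpair_eqE oner_eq0.
have h2 : 0 < h (s2, 1) by apply: h0; rewrite xpair_eqE oner_eq0 andbF.
exists (Num.min (h (1, s1)) (h (s2, 1))); first by rewrite lt_min h1.
have pow_norm (x : R) : `|x| ^+ (2 * k) = x ^+ (2 * k).
  by rewrite !exprM real_normK// num_real.
have quot (x y : R) : x != 0 -> `|y| <= `|x| -> y / x \in `[-1, 1].
  by move=> x0 yx; rewrite in_itv /= -ler_norml normrM normfV ler_pdivrMr ?mul1r// normr_gt0.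
move=> [x y]; have [yx|xy] := lerP `|y| `|x|.
  have [x0|x0] := eqVneq x 0.
    move: yx; rewrite x0 normr0 normr_le0 => /eqP ->.
    (* Homogeneity of positive degree forces [h] to vanish at 0. *)
    have -> : ((0, 0) : R * R) = 0 *: ((0, 0) : R * R) by rewrite scale0r.
    by rewrite hh scale0r normr0 expr0n muln_eq0 /= (gtn_eqF k0) mulr0 mul0r.
  rewrite prod_normE (max_l yx) /= pow_norm.
  have -> : h (x, y) = x ^+ (2 * k) * h (1, y / x).
    rewrite -hh; congr h; rewrite [RHS]surjective_pairing /=.
    by congr pair; rewrite /GRing.scale /= ?mulr1// mulrC divfK.
  rewrite mulrC; apply: ler_wpM2l; first by rewrite -pow_norm exprn_ge0.
  by rewrite ge_min m1// quot.
have y0 : y != 0 by rewrite -normr_gt0; exact: le_lt_trans xy.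
rewrite prod_normE (max_r (ltW xy)) /= pow_norm.
have -> : h (x, y) = y ^+ (2 * k) * h (x / y, 1).
  rewrite -hh; congr h; rewrite [RHS]surjective_pairing /=.
  by congr pair; rewrite /GRing.scale /= ?mulr1// mulrC divfK.
rewrite mulrC; apply: ler_wpM2l; first by rewrite -pow_norm exprn_ge0.
by rewrite ge_min m2 ?orbT// quot// ltW.
Qed.

(** The smaller of [p + q] and [p - q] is [p - |q|], so positive definiteness of both gives
    [p - |q|] a lower bound [c * |z| ^+ (2 * k)]. Each error term absorbs a quarter of [c], and half
    of it remains. *)
Lemma dominant_bounds (R : realType) k (p q : mpolynomial 2 R) (S T : tensor R 2 (2 * k))
    (e1 e2 : R * R -> R) :
  (0 < k)%N -> coef_tensor (p + q) S -> coef_tensor (p - q) T ->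
  positive_definite S -> positive_definite T ->
  e1 =o_ ((0, 0) : R * R) (fun z : R * R => `|z| ^+ (2 * k)) ->
  e2 =o_ ((0, 0) : R * R) (fun z : R * R => `|z| ^+ (2 * k)) ->
  exists2 c, 0 < c & \forall z \near ((0, 0) : R * R),
    `|eval2 q z| + `|e2 z| + c * `|z| ^+ (2 * k) <= eval2 p z - `|e1 z| /\
    eval2 p z + `|e1 z| <= 8^-1.
Proof.
move=> k0 pS pT S0 T0 /eqoP o1 /eqoP o2.
have [c1 c10 l1] := homogeneous_lower_bound k0 (@eval2_continuous _ (p + q))
  (eval2_homogeneous pS) (eval2_gt0 pS S0).
have [c2 c20 l2] := homogeneous_lower_bound k0 (@eval2_continuous _ (p - q))
  (eval2_homogeneous pT) (eval2_gt0 pT T0).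
pose c := Num.min c1 c2; have c0 : 0 < c by rewrite lt_min c10.
have pq z : `|eval2 q z| + c * `|z| ^+ (2 * k) <= eval2 p z.
  have pow0 : 0 <= `|z| ^+ (2 * k) by rewrite exprn_ge0.
  have := l2 z; rewrite eval2B => H2; have := l1 z; rewrite eval2D => H1.
  have H3 : c * `|z| ^+ (2 * k) <= c1 * `|z| ^+ (2 * k).
    by rewrite ler_wpM2r// ge_min lexx.
  have H4 : c * `|z| ^+ (2 * k) <= c2 * `|z| ^+ (2 * k).
    by rewrite ler_wpM2r// ge_min lexx orbT.
  by rewrite -lerBrDr ler_norml; apply/andP; split; lra.
have p0 : eval2 p 0 = 0.
  have z0 : (0 : R * R) = 0 *: 0 by rewrite scale0r.
  have z00 : (0 : R) ^+ (2 * k) = 0 by rewrite expr0n muln_eq0 /= (gtn_eqF k0).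
  have := eval2_homogeneous pT 0 0; rewrite scale0r z00 mul0r eval2B.
  have := eval2_homogeneous pS 0 0; rewrite scale0r z00 mul0r eval2D; lra.
exists (c / 2); first by rewrite divr_gt0.
have c4 : 0 < c / 4 by rewrite divr_gt0.
near=> z.
have H1 : `|e1 z| <= c / 4 * `|z| ^+ (2 * k).
  have -> : `|z| ^+ (2 * k) = `| `|z| ^+ (2 * k)| by rewrite ger0_norm ?exprn_ge0.
  by near: z; exact: o1.
have H2 : `|e2 z| <= c / 4 * `|z| ^+ (2 * k).
  have -> : `|z| ^+ (2 * k) = `| `|z| ^+ (2 * k)| by rewrite ger0_norm ?exprn_ge0.
  by near: z; exact: o2.
(* As [|e1 z|] is at most a quarter of [p], the bound 1/10 on [p] yields 1/10 + 1/40 = 1/8. *)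
have H3 : `|eval2 p 0 - eval2 p z| <= 10^-1.
  near: z; move/cvgrPdist_le: (@eval2_continuous _ p 0); apply; rewrite invr_gt0; exact: ltr0n.
have := pq z; have := normr_ge0 (eval2 q z); move: H3.
by rewrite p0 sub0r normrN => /(le_trans (ler_norm _)) *; split; lra.
Unshelve. all: by end_near. Qed.

(** * Planar maps *)

Lemma homogeneous_eval0 (R : realType) d (p : mpolynomial 2 R) :
  homogeneous d.+1 p -> eval2 p 0 = 0.
Proof.
have v0 i : tnth [tuple (0 : R * R).1; (0 : R * R).2] i = 0.
  by case: i => [[|[|//]] ?].
move=> /mpoly.dhomogP hp; rewrite /eval2 mpoly.mevalE big_seq big1// => m /hp hm.
have : mpoly.mdeg m = d.+1 := hm; rewrite mpoly.mdegE !big_ord_recl !big_ord0 !v0.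
case: (m ord0) => [|n]; last by rewrite exprS !mul0r mulr0.
case: (m (lift ord0 ord0)) => [//|n]; by rewrite exprS mul0r mul0r !mulr0.
Qed.

Lemma near0_norm_le (R : realType) (A : set (R * R)) :
  nbhs ((0, 0) : R * R) A -> exists2 e, 0 < e & forall z, `|z| <= e -> A z.
Proof.
move=> /nbhs_normP[e /= e0 He]; exists (e / 2); first by rewrite divr_gt0.
move=> z ze; apply: He; rewrite /ball_ /= sub0r normrN; lra.
Qed.

Lemma open_norm_lt (R : realType) (r : R) : open [set z : R * R | `|z| < r].
Proof.
rewrite (_ : mkset _ = Num.norm @^-1` [set t | t < r])//.
by apply: open_comp => // z _; exact: norm_continuous.
Qed.

Lemma partial_gradient (R : realType) m (f : R * R -> R) z :
  higher_order m f -> has_gradient f z (partial_x f z) (partial_y f z).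
Proof. by move=> [[df _ _] _ _ _]; exact: has_gradient_partial. Qed.

(** The terms are grouped as [1 - p11] and [- p12], the form used in [weak_saddle_of_gradient]. *)
Lemma planar_map_gradient1 (R : realType) (P Q : mpolynomial 2 R) m (X Y : R * R -> R) z :
  higher_order m X -> has_gradient (fun z => (planar_map P Q X Y z).1) z
    (1 - (eval2 (pderiv_x P) z - partial_x X z))
    (- (eval2 (pderiv_y P) z - partial_y X z)).
Proof.
move=> hX; have := has_gradientD (has_gradientD (has_gradient_fst z)
  (has_gradientN (eval2_gradient P z))) (partial_gradient z hX).
by congr has_gradient; ring.
Qed.

Lemma planar_map_gradient2 (R : realType) (P Q : mpolynomial 2 R) m (X Y : R * R -> R) z :
  higher_order m Y -> has_gradient (fun z => (planar_map P Q X Y z).2) z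
    (eval2 (pderiv_x Q) z + partial_x Y z)
    (1 + (eval2 (pderiv_y Q) z + partial_y Y z)).
Proof.
move=> hY; have := has_gradientD (has_gradientD (has_gradient_snd z)
  (eval2_gradient Q z)) (partial_gradient z hY).
by congr has_gradient; ring.
Qed.

Lemma planar_map_continuous (R : realType) (P Q : mpolynomial 2 R) m m' (X Y : R * R -> R) :
  higher_order m X -> higher_order m' Y -> continuous (planar_map P Q X Y).
Proof.
move=> hX hY z; have [d1 _] := planar_map_gradient1 P Q Y z hX.
have [d2 _] := planar_map_gradient2 P Q X z hY.
exact: (cvg_pair (differentiable_continuous d1) (differentiable_continuous d2)).
Qed.

Lemma perturbed_bounds (R : realType) (a b s t w w' u : R) :
  `|b| + `|t| + w <= a - `|s| -> a + `|s| <= u -> w' <= w ->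
  `|b + t| + w' <= a + s <= u.
Proof.
move=> H1 H2 ww'; have := ler_normD b t; have := ler_norm s.
have := ler_norm (- s); rewrite normrN => *; apply/andP; split; lra.
Qed.

Lemma planar_map_weak_saddle (R : realType) (k k' : nat) (P Q : mpolynomial 2 R)
    (X Y : R * R -> R) (C D : tensor R 2 (2 * k)) (E H : tensor R 2 (2 * k')) :
  (1 <= k)%N -> (1 <= k')%N ->
  homogeneous (2 * k + 1) P -> homogeneous (2 * k' + 1) Q ->
  higher_order (2 * k) X -> higher_order (2 * k') Y ->
  coef_tensor (pderiv_x P + pderiv_y P) C -> coef_tensor (pderiv_x P - pderiv_y P) D ->
  coef_tensor (pderiv_y Q + pderiv_x Q) E -> coef_tensor (pderiv_y Q - pderiv_x Q) H ->
  positive_definite C -> positive_definite D ->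
  positive_definite E -> positive_definite H ->
  exists r c m, 0 < r /\ weak_saddle r c m (planar_map P Q X Y).
Proof.
move=> k0 k0' hP hQ hX hY tC tD tE tH pC pD pE pH.
have [_ X0 oX1 oX2] := hX; have [_ Y0 oY1 oY2] := hY.
have [c1 c10 b1] := dominant_bounds k0 tC tD pC pD oX1 oX2.
have [c2 c20 b2] := dominant_bounds k0' tE tH pE pH oY2 oY1.
have [e1 e10 {}b1] := near0_norm_le b1; have [e2 e20 {}b2] := near0_norm_le b2.
(* The two components have bounds of different degrees [2 * k] and [2 * k']; since [r] is at most 1,
   both imply the bound with the common exponent [2 * k + 2 * k']. *)
pose r := Num.min 1 (Num.min e1 e2); pose c := Num.min c1 c2.
have r0 : 0 < r by rewrite !lt_min ltr01 e10.
have c0 : 0 < c by rewrite lt_min c10.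
have F0 : planar_map P Q X Y 0 = 0.
  rewrite /planar_map; rewrite addn1 in hP; rewrite addn1 in hQ.
  rewrite (homogeneous_eval0 hP) (homogeneous_eval0 hQ) -[0]/((0, 0) : R * R) X0 Y0.
  by rewrite subr0 !addr0.
have pow z c' n n' : `|z : R * R| <= r -> 0 < c' -> c <= c' -> (n <= n')%N ->
    c * `|z| ^+ n' <= c' * `|z| ^+ n.
  move=> zr c'0 cc' nn'; rewrite ler_pM ?exprn_ge0 ?(ltW c0)//.
  by rewrite ler_wiXn2l// (le_trans zr)// ge_min lexx.
exists r, (c / 2 ^+ (2 * k + 2 * k').+1), (2 * k + 2 * k').+1; split=> //.
apply: (@weak_saddle_of_gradient _ _ _ _ _
  (fun z => eval2 (pderiv_x P) z - partial_x X z)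
  (fun z => eval2 (pderiv_y P) z - partial_y X z)
  (fun z => eval2 (pderiv_x Q) z + partial_x Y z)
  (fun z => eval2 (pderiv_y Q) z + partial_y Y z)) => //.
- move=> a b; have [t t01 ->] := planar_MVT (fun z => planar_map_gradient1 P Q Y z hX) a b.
  by exists t => //; rewrite mulNr.
- move=> a b; have [t t01 ->] := planar_MVT (fun z => planar_map_gradient2 P Q X z hY) a b.
  by exists t => //; rewrite addrC.
- move=> z zr; have [|] := b1 z; first by rewrite (le_trans zr)// !ge_min lexx orbT.
  rewrite -(normrN (partial_x X z)) -(normrN (partial_y X z)).
  move=> /perturbed_bounds B /B; apply.
  by apply: pow => //; [rewrite ge_min lexx | exact: leq_addr].
- move=> z zr; have [|] := b2 z; first by rewrite (le_trans zr)// !ge_min lexx !orbT.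
  move=> /perturbed_bounds B /B; apply.
  by apply: pow => //; [rewrite ge_min lexx orbT | exact: leq_addl].
Qed.

(** * The local inverse and the exchange of coordinates *)

Lemma near_id_inj (R : realType) (r : R) (F : R * R -> R * R) :
  (forall a b, `|a| <= r -> `|b| <= r ->
    `|(F a - a) - (F b - b)| <= `|a - b| / 4) ->
  forall a b, `|a| <= r -> `|b| <= r -> F a = F b -> a = b.
Proof.
move=> Fq a b ar br Fab; have := Fq _ _ ar br.
rewrite subrBACA Fab subrr sub0r normrN => ab.
by apply/eqP; rewrite -subr_eq0 -normr_le0; have := normr_ge0 (a - b); lra.
Qed.

Lemma near_id_local_inverse (R : realType) (r : R) (F : R * R -> R * R) :
  0 < r -> F 0 = 0 -> continuous F ->
  (forall a b, `|a| <= r -> `|b| <= r ->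
    `|(F a - a) - (F b - b)| <= `|a - b| / 4) ->
  exists U V Finv, local_inverse F U V Finv.
Proof.
move=> r0 F0 Fc Fq; pose V := [set w : R * R | `|w| < r / 2].
pose inv w := xget 0 [set z | `|z| <= 2 * `|w| /\ F z = w].
have invP w : V w -> `|inv w| < r /\ F (inv w) = w.
  move=> Vw; have [z zw Fz] := near_id_surj r0 F0 Fq (ltW Vw).
  rewrite /inv; case: xgetP => [z' _ [z'w Fz']|/(_ z)]; last by case.
  by split=> //; rewrite (le_lt_trans z'w)// mulrC -ltr_pdivlMr.
have V_open : open V by exact: open_norm_lt.
(* Intersecting with the preimage of [V] makes [F] map the domain into [V]; on [V] the chosen
   preimage has norm below [r] and is unique there. *)
exists ([set z | `|z| < r] `&` F @^-1` V), V, inv; split.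
- split; last by rewrite /V /= -[(0, 0)]/(0 : R * R) F0 normr0 r0 divr_gt0.
  by apply: openI; [exact: open_norm_lt | apply: open_comp => // z _; exact: Fc].
- by split=> //; rewrite /V /= -[(0, 0)]/(0 : R * R) normr0 divr_gt0.
- move=> z [zr Vz]; split=> //; have [ir iF] := invP _ Vz.
  exact: (near_id_inj Fq (ltW ir) (ltW zr)).
- by move=> w Vw; have [ir iF] := invP _ Vw; split=> //; split=> //; rewrite /preimage /= iF.
Qed.

Lemma iter_swap (R : realType) (G : R * R -> R * R) j z :
  iter j (swap \o G \o swap) (swap z) = swap (iter j G z).
Proof.
elim: j => //= j ->; congr (swap (G _)).
by rewrite /swap /= -surjective_pairing.
Qed.

Lemma unstable_set_swap (R : realType) (G : R * R -> R * R) (d : R) z :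
  unstable_set G [set z | `|z| <= d] z <->
  stable_set (swap \o G \o swap) [set z | `|z| <= d] (swap z).
Proof.
have swap_cvg (u : nat -> R * R) : u @ \oo --> ((0, 0) : R * R) ->
    (fun j => swap (u j)) @ \oo --> ((0, 0) : R * R).
  move=> cu; apply: (cvg_pair (cvg_comp _ _ cu cvg_snd) (cvg_comp _ _ cu cvg_fst)).
have swapK : involutive (@swap R) by move=> [].
have iterE : (fun j => iter j (swap \o G \o swap) (swap z)) = fun j => swap (iter j G z).
  by apply/funext => j; exact: iter_swap.
rewrite /unstable_set /stable_set /= norm_swap iterE.
split=> -[zd Nz cz]; split=> //.
- by move=> j; rewrite iter_swap norm_swap.
- exact: swap_cvg.
- by move=> j; have := Nz j; rewrite iter_swap norm_swap.
- have := swap_cvg _ cz.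
  rewrite (_ : (fun j => swap (swap _)) = fun j => iter j G z)//.
  by apply/funext => j; exact: swapK.
Qed.

Lemma lipschitz1W (R : realType) (d : R) (f : R -> R) : 0 < d ->
  (1 : R).-lipschitz_`[- d, d] f -> [lipschitz f x | x in `[- d, d]].
Proof.
move=> d0; apply: klipschitzW.
(* The pair [(0, 0)] witnesses that the domain is nonempty, so that the filter is proper. *)
apply: (@globally_properfilter _ _ (0, 0)).
by split; rewrite /= in_itv /= oppr_le0 ltW.
Qed.

Theorem theorem1p1 (R : realType) (k k' : nat) (hk : (1 <= k)%N)
  (hk' : (1 <= k')%N) (P Q : mpolynomial 2 R)
  (hP : homogeneous (2 * k + 1) P) (hQ : homogeneous (2 * k' + 1) Q)
  (X Y : R * R -> R)
  (hX : higher_order (2 * k) X) (hY : higher_order (2 * k') Y)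
  (A C D : tensor R 2 (2 * k)) (B E H : tensor R 2 (2 * k'))
  (hA : coef_tensor (pderiv_x P) A)
  (hB : coef_tensor (pderiv_y Q) B)
  (hC : coef_tensor (pderiv_x P + pderiv_y P) C)
  (hD : coef_tensor (pderiv_x P - pderiv_y P) D)
  (hE : coef_tensor (pderiv_y Q + pderiv_x Q) E)
  (hH : coef_tensor (pderiv_y Q - pderiv_x Q) H)
  (pA : positive_definite A) (pB : positive_definite B)
  (pC : positive_definite C) (pD : positive_definite D)
  (pE : positive_definite E) (pH : positive_definite H) :
  let F := planar_map P Q X Y in
  (exists U V Finv, local_inverse F U V Finv) /\
  forall U V Finv, local_inverse F U V Finv ->
  exists (N : set (R * R)) (delta : R) (phis phiu : R -> R),
    [/\ nbhs ((0, 0) : R * R) N, N `<=` V & 0 < delta] /\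
    [/\ [lipschitz phis x | x in `[- delta, delta]],
        [lipschitz phiu y | y in `[- delta, delta]],
        stable_set F N = [set (x, phis x) | x in `[- delta, delta]] &
        unstable_set Finv N = [set (phiu y, y) | y in `[- delta, delta]]].
Proof.
move=> F; have [r [c [m [r0 sF]]]] := planar_map_weak_saddle
  hk hk' hP hQ hX hY hC hD hE hH pC pD pE pH.
have F0 := weak_saddle0 sF; have Fq := weak_saddle_near_id sF.
split; first exact: near_id_local_inverse r0 F0 (planar_map_continuous hX hY) Fq.
move=> U V Finv [[Uo U0] [Vo V0] FU _].
have [e1 e10 inU] := near0_norm_le (open_nbhs_nbhs (conj Uo U0)).
have [e2 e20 inV] := near0_norm_le (open_nbhs_nbhs (conj Vo V0)).
(* Halved because the preimage of [w] found by contraction has norm up to [2 * |w|] and must still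
   lie in [U] and in the square of radius [r]. *)
pose d := Num.min r (Num.min e1 e2) / 2.
have d0 : 0 < d by rewrite divr_gt0// !lt_min r0 e10.
have dE : 2 * d = Num.min r (Num.min e1 e2) by rewrite /d mulrC divfK.
have d2r : 2 * d <= r by rewrite dE ge_min lexx.
have d2e1 : 2 * d <= e1 by rewrite dE !ge_min lexx orbT.
have d2e2 : 2 * d <= e2 by rewrite dE !ge_min lexx !orbT.
have dr : d <= r by lra.
have FinvP w : `|w| <= d -> `|Finv w| <= r /\ F (Finv w) = w.
  move=> wd; have wr : `|w| <= r / 2 by lra.
  have [z zw Fz] := near_id_surj r0 F0 Fq wr.
  have Uz : U z by apply: inU; lra.
  (* As [z] lies in [U], the given local inverse must send [w = F z] to [z]; so any local inverse
     agrees on the square with the preimage found by contraction. *)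
  by have [_] := FU _ Uz; rewrite /F Fz => ->; split=> //; lra.
have sS := weak_saddle_saddle d0 dr sF.
have sU := weak_saddle_inv_saddle d0 dr sF FinvP.
have [phis [Lphis Ephis]] := saddle_stable_graph sS.
have [phiu [Lphiu Ephiu]] := saddle_stable_graph sU.
exists [set z : R * R | `|z| <= d], d, phis, phiu; split; split=> //.
- have : open_nbhs ((0, 0) : R * R) [set z | `|z| < d].
    by split; [exact: open_norm_lt | rewrite /= -[(0, 0)]/(0 : R * R) normr0].
  by move=> /open_nbhs_nbhs; apply: filterS => z /ltW.
- by move=> z zd; apply: inV; apply: le_trans zd _; lra.
- exact: lipschitz1W.
- exact: lipschitz1W.
(* Exchanging the coordinates turns the graph of [phiu] over the first axis into a graph over the
   second. *)
apply/seteqP; split=> z.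
  move=> /unstable_set_swap; rewrite Ephiu => -[y yd].
  by case: z => z1 z2 [<- <-]; exists y.
move=> [y yd <-]; apply/unstable_set_swap; rewrite Ephiu.
by exists y.
Qed.
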